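(* Let $A$ and $B$ be unital $C^*$-algebras, let $E$ be a finitely or countably generated Hilbert $A$-module and $F$ a finitely or countably generated Hilbert $B$-module, and let $I,J$ be countable index sets. Let $\{u_i\}_{i\in I}$ and $\{v_j\}_{j\in J}$ be standard frames in $E$ and $F$, respectively. If $S$, $S'$ and $S''$ are the frame operators of $\{u_i\}_{i\in I}$, $\{v_j\}_{j\in J}$ and $\{u_i\otimes v_j\}_{i\in I,\,j\in J}$ (the latter being a standard frame for the Hilbert $A\otimes B$-module $E\otimes F$), respectively, then $S''=S\otimes S'$.
   Context: A Hilbert $A$-module is a left $A$-module $H$ (with compatible linear structures) equipped with an $A$-valued inner product $\langle\cdot,\cdot\rangle$ such that $\langle x,x\rangle\ge 0$, with equality iff $x=0$; $\langle ax+y,z\rangle=a\langle x,z\rangle+\langle y,z\rangle$ for $a\in A$; $\langle x,y\rangle=\langle y,x\rangle^*$; and $H$ is complete for $\|x\|=\|\langle x,x\rangle\|^{1/2}$. $\mathrm{End}_A^*(H)$ is the set of adjointable $A$-linear maps on $H$. A family $\{x_i\}_{i\in I}$ in $H$ is a standard frame if there are real constants $0<C\le D<\infty$ such that for all $x\in H$ one has $C\langle x,x\rangle\le\sum_{i\in I}\langle x,x_i\rangle\langle x_i,x\rangle\le D\langle x,x\rangle$, the sum converging in norm in $A$. Frame operator (the convention used here, in which it is the inverse of the map $x\mapsto\sum_i\langle x,x_i\rangle x_i$): for a standard frame $\{x_i\}_{i\in I}$ in a finitely or countably generated Hilbert $A$-module $H$, the frame operator is the unique $S\in\mathrm{End}_A^*(H)$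 such that for every $x\in H$ $$x=\sum_{i\in I}\langle x,Sx_i\rangle x_i=\sum_{i\in I}\langle x,x_i\rangle Sx_i .$$ It is positive and invertible. $A\otimes B$ is the completion of the algebraic tensor product in the spatial (minimal) $C^*$-norm. $E\otimes F$ is the Hilbert $A\otimes B$-module obtained by completing the algebraic tensor product of $E$ and $F$ with module action $(a\otimes b)(x\otimes y)=ax\otimes by$ and inner product $\langle x_1\otimes y_1,x_2\otimes y_2\rangle=\langle x_1,x_2\rangle\otimes\langle y_1,y_2\rangle$. $S\otimes S'$ is the bounded operator on $E\otimes F$ determined by $(S\otimes S')(x\otimes y)=Sx\otimes S'y$. *)

(* Defs.v *)
From HB Require Import structures.
From mathcomp Require Import all_boot all_order all_algebra finmap.
From mathcomp Require Import all_classical all_reals all_analysis.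
From mathcomp.analysis.showcase Require Import summability.
From mathcomp Require Import complex.

Set Implicit Arguments.
Unset Strict Implicit.
Unset Printing Implicit Defensive.

Import Order.TTheory GRing.Theory Num.Theory numFieldNormedType.Exports.

Local Open Scope classical_set_scope.
Local Open Scope ring_scope.
Local Open Scope complex_scope.

(** Norms of complex normed modules take their values in [R[i]]. *)

(** Unital C*-algebras, the zero algebra included.  Multiplication is a field
    of the mixin because Hierarchy Builder refuses a join of a ring and a normed
    module other than [numDomainType]. *)
HB.mixin Record CompleteNormedModule_isCStarAlgebra (R : realType) A
    of CompleteNormedModule R[i] A := {
  cone : A;
  cmul : A -> A -> A;
  cmulA : associative cmul;
  cmul1a : left_id cone cmul;
  cmula1 : right_id cone cmul;
  cmulDl : left_distributive cmul +%R;
  cmulDr : right_distributive cmul +%R;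
  cmulZl : forall (k : R[i]) (a b : A), cmul (k *: a) b = k *: cmul a b;
  cmulZr : forall (k : R[i]) (a b : A), cmul a (k *: b) = k *: cmul a b;
  star : A -> A;
  starK : involutive star;
  starD : forall a b : A, star (a + b) = star a + star b;
  starZ : forall (k : R[i]) (a : A), star (k *: a) = Num.conj k *: star a;
  starM : forall a b : A, star (cmul a b) = cmul (star b) (star a);
  cmul_norm : forall a b : A, `|cmul a b| <= `|a| * `|b|;
  cstar_norm : forall a : A, `|cmul (star a) a| = `|a| ^+ 2
}.

#[short(type="cstarAlgType")]
HB.structure Definition CStarAlgebra (R : realType) :=
  {A of CompleteNormedModule R[i] A & CompleteNormedModule_isCStarAlgebra R A}.

Definition cstar_pos (R : realType) (A : cstarAlgType R) (a : A) : Prop :=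
  exists b : A, a = cmul (star b) b.

Definition cstar_le (R : realType) (A : cstarAlgType R) (a b : A) : Prop :=
  cstar_pos (b - a).

(** [E] is a complex Banach space for the module norm ([inner_norm]); the
    left action of [A] is a separate operation because [*:] is already the
    action of [R[i]]. *)
HB.mixin Record CompleteNormedModule_isHilbertModule
    (R : realType) (A : cstarAlgType R) E of CompleteNormedModule R[i] E := {
  act : A -> E -> E;
  act1 : forall x : E, act cone x = x;
  actA : forall (a b : A) (x : E), act a (act b x) = act (cmul a b) x;
  actDl : forall (a b : A) (x : E), act (a + b) x = act a x + act b x;
  actDr : forall (a : A) (x y : E), act a (x + y) = act a x + act a y;
  actZl : forall (k : R[i]) (a : A) (x : E), act (k *: a) x = k *: act a x;
  actZr : forall (k : R[i]) (a : A) (x : E), act a (k *: x) = k *: act a x;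
  inner : E -> E -> A;
  inner_pos : forall x : E, cstar_pos (inner x x);
  inner_eq0 : forall x : E, inner x x = 0 <-> x = 0;
  inner_linear : forall (a : A) (x y z : E),
    inner (act a x + y) z = cmul a (inner x z) + inner y z;
  inner_star : forall x y : E, inner x y = star (inner y x);
  inner_norm : forall x : E, `|x| ^+ 2 = `|inner x x|
}.

#[short(type="hilbertModType")]
HB.structure Definition HilbertModule (R : realType) (A : cstarAlgType R) :=
  {E of CompleteNormedModule R[i] E
      & CompleteNormedModule_isHilbertModule R A E}.

HB.mixin Record CompleteNormedModule_isHilbertSpace (R : realType) H
    of CompleteNormedModule R[i] H := {
  dot : H -> H -> R[i];
  dot_linear : forall (k : R[i]) (x y z : H),
    dot (k *: x + y) z = k * dot x z + dot y z;
  dot_conj : forall x y : H, dot x y = Num.conj (dot y x);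
  dot_norm : forall x : H, `|x| ^+ 2 = dot x x
}.

#[short(type="hilbertSpaceType")]
HB.structure Definition HilbertSpace (R : realType) :=
  {H of CompleteNormedModule R[i] H & CompleteNormedModule_isHilbertSpace R H}.

(** Unordered sum: norm limit of the net of finite partial sums. *)
Definition has_sum (R : realType) (V : normedModType R[i]) (I : choiceType)
    (f : I -> V) (s : V) : Prop :=
  partial_sum f @ totally --> s.

Definition bounded_op (R : realType) (V W : normedModType R[i])
    (T : V -> W) : Prop :=
  exists M : R, forall x : V, `|T x| <= M%:C * `|x|.

Section Frames.
Variables (R : realType) (A : cstarAlgType R) (E : hilbertModType A).

Definition finitely_generated : Prop :=
  exists (n : nat) (g : 'I_n -> E),
    forall x : E, exists a : 'I_n -> A, x = \sum_(i < n) act (a i) (g i).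

Definition countably_generated : Prop :=
  exists g : nat -> E,
    closure [set x : E | exists (n : nat) (a : nat -> A),
                           x = \sum_(i < n) act (a i) (g i)] = setT.

Definition adjointable (S : E -> E) : Prop :=
  (forall (a : A) (x y : E), S (act a x + y) = act a (S x) + S y) /\
  (exists S' : E -> E, forall x y : E, inner (S x) y = inner x (S' y)).

Definition standard_frame (I : choiceType) (u : I -> E) : Prop :=
  exists C D : R, [/\ 0 < C, C <= D &
    forall x : E, exists s : A,
      [/\ has_sum (fun i => cmul (inner x (u i)) (inner (u i) x)) s,
          cstar_le (C%:C *: inner x x) s &
          cstar_le s (D%:C *: inner x x)]].

(** The frame operator of a frame [u] is the only such [S]. *)
Definition frame_operator (I : choiceType) (u : I -> E) (S : E -> E) : Prop :=
  adjointable S /\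
  forall x : E, has_sum (fun i => act (inner x (S (u i))) (u i)) x /\
                has_sum (fun i => act (inner x (u i)) (S (u i))) x.

End Frames.

Section TensorProducts.
Variable R : realType.

Definition bilinear_map (U V W : lmodType R[i]) (t : U -> V -> W) : Prop :=
  (forall v, linear (t^~ v)) /\ (forall u, linear (t u)).

(** The image of the algebraic tensor product is dense. *)
Definition dense_tensors (U V : Type) (W : normedModType R[i])
    (t : U -> V -> W) : Prop :=
  closure [set w : W | exists z : seq (U * V),
                         w = \sum_(p <- z) t p.1 p.2] = setT.

(** [t] exhibits [L] as the Hilbert space tensor product of [H] and [K]. *)
Definition hilbert_space_tensor (H K L : hilbertSpaceType R)
    (t : H -> K -> L) : Prop :=
  [/\ bilinear_map t,
      (forall h h' k k', dot (t h k) (t h' k') = dot h h' * dot k k') &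
      dense_tensors t].

(** *-representations on a Hilbert space, possibly degenerate. *)
Definition representation (A : cstarAlgType R) (H : hilbertSpaceType R)
    (rho : A -> H -> H) : Prop :=
  [/\ bilinear_map rho,
      (forall a, bounded_op (rho a)),
      (forall a b h, rho (cmul a b) h = rho a (rho b h)) &
      (forall a h k, dot (rho a h) k = dot h (rho (star a) k))].

(** The set of the values |(rho (x) sigma)(c) zeta|, where [c] is the sum of the
    [a (x) b] for [(a, b)] in [s], [rho] and [sigma] are representations of [A]
    and [B], and [zeta] (the sum of the [h (x) k] for [(h, k)] in [z]) is in the
    unit ball of the algebraic tensor product of their spaces, which is dense
    in that of the Hilbert tensor product [L].  Its supremum is the spatial norm
    sup |(rho (x) sigma)(c)| over all pairs of representations. *)
Definition spatial_values (A B : cstarAlgType R) (s : seq (A * B)) : set R[i] :=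
  [set r | exists (H K L : hilbertSpaceType R) (t : H -> K -> L)
                  (rho : A -> H -> H) (sigma : B -> K -> K) (z : seq (H * K)),
     [/\ hilbert_space_tensor t, representation rho, representation sigma,
         `|\sum_(q <- z) t q.1 q.2| <= 1 &
         r = `|\sum_(p <- s) \sum_(q <- z) t (rho p.1 q.1) (sigma p.2 q.2)|]].

(** [t] exhibits [AB] as the completion of the algebraic tensor product of [A]
    and [B] in the spatial norm; it is unique up to isometric isomorphism. *)
Definition spatial_tensor (A B AB : cstarAlgType R) (t : A -> B -> AB) : Prop :=
  [/\ bilinear_map t,
      (forall a a' b b', cmul (t a b) (t a' b') = t (cmul a a') (cmul b b')),
      (forall a b, star (t a b) = t (star a) (star b)),
      (forall s : seq (A * B),
         supremums (spatial_values s) `|\sum_(p <- s) t p.1 p.2|) &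
      dense_tensors t].

(** [tEF] exhibits [EF] as the exterior tensor product of [E] and [F]. *)
Definition hilbert_module_tensor (A B AB : cstarAlgType R)
    (tAB : A -> B -> AB) (E : hilbertModType A) (F : hilbertModType B)
    (EF : hilbertModType AB) (tEF : E -> F -> EF) : Prop :=
  [/\ bilinear_map tEF,
      (forall a b x y, act (tAB a b) (tEF x y) = tEF (act a x) (act b y)),
      (forall x x' y y',
         inner (tEF x y) (tEF x' y') = tAB (inner x x') (inner y y')) &
      dense_tensors tEF].

(** [T] is [S (x) S'], the only bounded operator with these values. *)
Definition tensor_operator (E F EF : normedModType R[i]) (t : E -> F -> EF)
    (S : E -> E) (S' : F -> F) (T : EF -> EF) : Prop :=
  [/\ linear T, bounded_op T & forall x y, T (t x y) = t (S x) (S' y)].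

End TensorProducts.

(* Main.v *)
Require Import Defs.
From HB Require Import structures.
From mathcomp Require Import all_boot all_order all_algebra finmap.
From mathcomp Require Import all_classical all_reals all_analysis.
From mathcomp.analysis.showcase Require Import summability.
From mathcomp Require Import complex lra ring.

(** Every frame operator [S] is self-adjoint: pairing the expansion of [x] in
    the vectors [S (u i)] with [y] shows that [<S x, y>] is the sum of the
    [<x, S u_i> <S u_i, y>], an expression that the involution turns into the
    same one with [x] and [y] exchanged ([frame_operator_selfadjoint]).  Hence
    [x] is the sum of the [<S x, u_i> u_i]: [S] inverts the map sending [x] to
    the sum of the [<x, u_i> u_i] ([frame_operator_inverse]).

    For the tensor frame, put [w = S x (x) S' y].  By definition of [S''], [w] is
    the sum of the [<w, u_i (x) v_j> S'' (u_i (x) v_j)], whose general term is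
    [S''] applied to [<S x, u_i> u_i (x) <S' y, v_j> v_j].  Summed over
    rectangles, the arguments of [S''] tend to [x (x) y], so that
    [w = S'' (x (x) y)].  The limit is taken after pairing with an arbitrary
    vector [z], where [S''] moves to the other side as its adjoint [T]: what is
    used is the joint continuity of the bilinear map sending [(x, y)] to
    [<x (x) y, T z>] ([has_sum_bilinear]).

    Three analytic facts remain.
    - The tensor product of modules is a bounded bilinear map because
      [|a (x) b| <= |a| |b|] for the spatial norm.  This is a property of pairs
      of representations, and both factors are handled by one estimate on
      positive functionals, [f (a* a) <= |a|^2 f 1], which follows from the
      existence of a self-adjoint square root of [1 - a] for [a] self-adjoint of
      norm less than 1 ([sqrt_one_sub], [positive_functional_le],
      [orbit_norm_le], [spatial_tensor_norm_le]).
    - The inner product is bounded.  Polarization gives this with a constant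
      that is not sharp but does not involve the order of the algebra
      ([inner_norm_le]).
    - An adjointable map is bounded, by the uniform boundedness principle
      ([adjointable_bounded]). *)

Set Implicit Arguments.
Unset Strict Implicit.
Unset Printing Implicit Defensive.

Import Order.TTheory GRing.Theory Num.Theory numFieldNormedType.Exports.

Local Open Scope classical_set_scope.
Local Open Scope ring_scope.
Local Open Scope complex_scope.

(** * Limits at a geometric rate *)

Lemma geometric_lt (R : realType) (c q e : R) :
  0 <= q < 1 -> 0 < e -> exists n, forall m, (n <= m)%N -> c * q ^+ m < e.
Proof.
move=> /andP[q0 q1] e0.
have := @cvg_geometric R c q; rewrite ger0_norm// => /(_ q1)/cvgrPdist_lt/(_ _ e0).
move=> [n _ H]; exists n => m nm; have := H m nm; rewrite /= sub0r normrN.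
exact/le_lt_trans/ler_norm.
Qed.

Lemma geometric_le0 (R : realType) (x : R[i]) (c q : R) :
  0 <= q < 1 -> (forall n, x <= (c * q ^+ n)%:C) -> x <= 0.
Proof.
move=> q01 H; have := H 0; case: x H => [a b] H; rewrite !lecE/= => /andP[/eqP<- _].
rewrite eqxx/=; apply/ler_addgt0Pr => e e0.
have [n /(_ n (leqnn n))] := @geometric_lt R c q e q01 e0.
rewrite add0r => /ltW; apply: le_trans.
by have := H n; rewrite lecE/= => /andP[].
Qed.

Lemma ge0_realE (R : realType) (e : R[i]) :
  0 <= e -> exists2 r : R, 0 <= r & e = r%:C.
Proof. by case: e => [a b]; rewrite lecE/= => /andP[/eqP-> a0]; exists a. Qed.

Lemma gt0_realE (R : realType) (e : R[i]) :
  0 < e -> exists2 r : R, 0 < r & e = r%:C.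
Proof. by case: e => [a b]; rewrite ltcE/= => /andP[/eqP-> a0]; exists a. Qed.

(** A sequence with geometrically small steps converges; the limit is recorded
    only through the rate, which is what the estimates below consume.  It serves
    both the square root iteration and the gliding hump. *)
Lemma geometric_limit (R : realType) (V : completeNormedModType R[i])
    (u : nat -> V) (c q : R) :
  0 <= q < 1 -> (forall n, `|u n.+1 - u n| <= (c * q ^+ n)%:C) ->
  exists l, forall n, `|l - u n| <= (c / (1 - q) * q ^+ n)%:C.
Proof.
move=> q01 ub; have /andP[q0 q1] := q01.
have q1' : 1 - q != 0 by rewrite subr_eq0 gt_eqF.
have c0 : 0 <= c.
  have := le_trans (normr_ge0 _) (ub 0); rewrite expr0 mulr1.
  by rewrite lecE/= => /andP[].
have d0 : 0 <= c / (1 - q) by rewrite divr_ge0// subr_ge0 ltW.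
have dist n k : `|u (n + k)%N - u n| <= (c / (1 - q) * (q ^+ n - q ^+ (n + k)))%:C.
  elim: k => [|k ih]; first by rewrite addn0 !subrr normr0 mulr0.
  rewrite addnS; apply: le_trans (ler_distD (u (n + k)%N) _ _) _.
  apply: le_trans (lerD (ub _) ih) _; rewrite -rmorphD lecR le_eqVlt.
  apply/orP; left; apply/eqP; rewrite exprS.
  by field.
have dist' n k : (n <= k)%N -> `|u k - u n| <= (c / (1 - q) * q ^+ n)%:C.
  move=> nk; rewrite -(subnKC nk); apply: le_trans (dist _ _) _.
  by rewrite lecR ler_wpM2l// gerBl exprn_ge0.
have cu : cauchy (u @ \oo).
  apply: cauchy_exP => e e0.
  have [r r0 ->] := gt0_realE e0.
  have [n /(_ n (leqnn n)) nP] := geometric_lt (c / (1 - q)) q01 r0.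
  exists (u n); exists n => //= k /= nk.
  rewrite -ball_normE /= distrC; apply: le_lt_trans (dist' _ _ nk) _.
  by rewrite ltcR.
have cvu : cvg (u @ \oo) by apply/cauchy_cvgP.
exists (lim (u @ \oo)) => n.
have [a a0 aE] := ge0_realE (normr_ge0 (lim (u @ \oo) - u n)); rewrite aE lecR.
apply/ler_addgt0Pr => e e0; rewrite -lecR -aE.
have /cvgrPdist_lt/(_ e%:C) := cvu; rewrite ltcR => /(_ e0) [N _ NP].
apply: le_trans (ler_distD (u (maxn n N)) _ _) _.
rewrite addrC rmorphD; apply: lerD; first exact/dist'/leq_maxl.
exact/ltW/NP/leq_maxr.
Qed.

(** * C*-algebras: square roots and positive functionals *)

Section CStarAlgebraTheory.
Variables (R : realType) (A : cstarAlgType R).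
Implicit Types a b c : A.

Lemma norm_star a : `|star a| = `|a|.
Proof.
have le_star b : `|b| <= `|star b|.
  have [->|b0] := eqVneq b 0; first by rewrite normr0.
  rewrite -(ler_pM2r (_ : 0 < `|b|)) ?normr_gt0//.
  by rewrite -expr2 -cstar_norm cmul_norm.
apply: le_anti; rewrite le_star andbT.
by have := le_star (star a); rewrite starK.
Qed.

Lemma cmulNr a b : cmul a (- b) = - cmul a b.
Proof. by rewrite -scaleN1r cmulZr scaleN1r. Qed.

Lemma cmulNl a b : cmul (- a) b = - cmul a b.
Proof. by rewrite -scaleN1r cmulZl scaleN1r. Qed.

Lemma starN a : star (- a) = - star a.
Proof. by rewrite -scaleN1r starZ rmorphN1 scaleN1r. Qed.

Lemma starB a b : star (a - b) = star a - star b.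
Proof. by rewrite starD starN. Qed.

Lemma star1 : star (cone : A) = cone.
Proof. by have := starM (star cone) (cone : A); rewrite cmula1 starK cmula1. Qed.

Lemma norm_sqrB a b :
  `|cmul a a - cmul b b| <= (`|a| + `|b|) * `|a - b|.
Proof.
have -> : cmul a a - cmul b b = cmul a (a - b) + cmul (a - b) b.
  by rewrite cmulDr cmulDl cmulNr cmulNl addrA subrK.
apply: le_trans (ler_normD _ _) _; rewrite mulrDl lerD ?cmul_norm//.
by rewrite mulrC cmul_norm.
Qed.

(** Writing the root as [1 - y], the equation [(1 - y)^2 = 1 - a] becomes
    [y = (a + y^2) / 2].  On the ball of radius [|a| < 1] the right-hand side is a
    contraction of ratio [|a|] that preserves self-adjointness. *)
Lemma sqrt_one_sub a : star a = a -> `|a| < 1 ->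
  exists2 b, star b = b & cmul b b = cone - a.
Proof.
move=> sa; have [q q0 aE] := ge0_realE (normr_ge0 a); rewrite aE ltcR => q1.
have q01 : 0 <= q < 1 by rewrite q0.
pose F y : A := 2^-1 *: (a + cmul y y); pose u n := iter n F 0.
have half2 (x : R[i]) : 2^-1 * (x + x) = x by field.
have nhalf : `|2^-1 : R[i]| = 2^-1 by rewrite ger0_norm ?invr_ge0.
have FB y z : `|F y - F z| <= 2^-1 * ((`|y| + `|z|) * `|y - z|).
  rewrite /F -scalerBr normrZ nhalf opprD addrACA subrr add0r.
  by rewrite ler_wpM2l ?invr_ge0// norm_sqrB.
have uq n : `|u n| <= q%:C.
  elim: n => [|n ih]; first by rewrite normr0 lecR.
  rewrite /u/= normrZ nhalf -[leRHS]half2 ler_wpM2l ?invr_ge0//.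
  apply: le_trans (ler_normD _ _) _; rewrite aE lerD2l.
  apply: le_trans (cmul_norm _ _) _.
  apply: le_trans (ler_pM _ _ ih ih) _ => //.
  by rewrite -rmorphM lecR ler_piMl// ltW.
have su n : star (u n) = u n.
  elim: n => [|n ih]; first by rewrite /u/= -(subrr (0 : A)) starB !subrr.
  by rewrite /u/= starZ starD starM sa -/(u n) ih fmorphV rmorph_nat.
have du n : `|u n.+1 - u n| <= (1 * q ^+ n)%:C.
  rewrite mul1r; elim: n => [|n ih].
    by rewrite subr0; apply: le_trans (uq 1) _; rewrite lecR ltW.
  apply: le_trans (FB (u n.+1) (u n)) _.
  rewrite -[leRHS]half2 ler_wpM2l ?invr_ge0//.
  apply: (@le_trans _ _ ((q%:C + q%:C) * (q ^+ n)%:C)).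
    by apply: ler_pM => //; apply: lerD.
  by rewrite mulrDl -!rmorphM -exprS.
have [l lP] := geometric_limit q01 du.
have [m m0 lE] := ge0_realE (normr_ge0 l).
have Fl : F l = l.
  apply/eqP; rewrite -subr_eq0 -normr_le0.
  pose c := 2^-1 * (m + q) * (1 / (1 - q)) + 1 / (1 - q) * q.
  apply: (@geometric_le0 _ _ c q) => // n; rewrite /c.
  apply: le_trans (ler_distD (u n.+1) _ _) _.
  rewrite [leRHS](_ : _ = 2^-1 * ((m%:C + q%:C) * ((1 / (1 - q)) * q ^+ n)%:C)
    + ((1 / (1 - q)) * q ^+ n.+1)%:C); last first.
    rewrite exprS !(rmorphM, rmorphD)/= fmorphV rmorph_nat; ring.
  apply: lerD; last by rewrite distrC.
  apply: le_trans (FB _ _) _; rewrite ler_wpM2l ?invr_ge0//.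
  by apply: ler_pM => //; rewrite lerD// lE.
have sl : star l = l.
  apply/eqP; rewrite -subr_eq0 -normr_le0.
  apply: (@geometric_le0 _ _ (1 / (1 - q) + 1 / (1 - q)) q) => // n.
  apply: le_trans (ler_distD (u n) _ _) _; rewrite mulrDl rmorphD lerD//.
    by rewrite -{1}su -starB norm_star.
  by rewrite distrC.
exists (cone - l); first by rewrite starB star1 sl.
rewrite cmulDl cmulDr cmulNr cmulNl cmul1a cmul1a cmulDr cmulNr cmula1.
have -> : a = l + l - cmul l l.
  rewrite -{1 2}Fl -scalerDl.
  have -> : 2^-1 + 2^-1 = 1 :> R[i] by field.
  by rewrite scale1r addrK.
by rewrite !opprD !opprK !addrA.
Qed.

(** For [v > |a|^2], the element [1 - a* a / v] is a square [k* k], so that [f]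
    is nonnegative on it; then [v] decreases to [|a|^2]. *)
Lemma positive_functional_le (f : A -> R[i]) :
  scalar f ->
  (forall a, 0 <= f (cmul (star a) a)) ->
  forall a, f (cmul (star a) a) <= `|a| ^+ 2 * f cone.
Proof.
move=> flin fpos a.
have f1 : 0 <= f cone by rewrite -[cone]cmul1a -[in X in cmul X _]star1 fpos.
have [r r0 aE] := ge0_realE (normr_ge0 a).
have [t t0 tE] := ge0_realE f1.
have [s s0 sE] := ge0_realE (fpos a).
rewrite aE tE sE -rmorphXn -rmorphM lecR.
apply/ler_addgt0Pr => e e0.
(* The slack [d] in [v] costs at most [d * t <= e] in the conclusion. *)
pose d := e / (t + 1); have d0 : 0 < d by rewrite divr_gt0// ltr_wpDl.
pose v := r ^+ 2 + d; have v0 : 0 < v by rewrite ltr_wpDl ?exprn_ge0.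
have [||k sk kE] := @sqrt_one_sub (v^-1%:C *: cmul (star a) a).
- rewrite starZ starM starK; congr (_ *: _).
  by apply/CrealP; rewrite ger0_real// lecR invr_ge0 ltW.
- rewrite normrZ cstar_norm aE ger0_norm ?lecR ?invr_ge0 ?(ltW v0)//.
  by rewrite -rmorphXn -rmorphM ltcR mulrC ltr_pdivrMr// mul1r ltrDl.
have := fpos k; rewrite sk kE -scaleNr addrC flin sE tE.
rewrite -rmorphN -rmorphM -rmorphD lecR mulNr addrC subr_ge0.
rewrite mulrC ler_pdivrMr// mulrC => /le_trans; apply.
rewrite mulrDl lerD2l /d mulrAC ler_pdivrMr ?ltr_wpDl//.
by rewrite ler_wpM2l ?(ltW e0)// lerDl.
Qed.

(** [p a] stands for [pi a w] with [pi] a *-representation of [A]: the functional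
    mapping [a] to [<pi a w, w>] is then positive.  Only the orbit of [w] appears,
    because a representation tensored with the identity is here given on finite
    sums of elementary tensors and not on the whole Hilbert space.  The vector
    [pi 1 w] is the projection of [w] on the essential subspace and may differ
    from [w]. *)
Lemma orbit_norm_le (L : hilbertSpaceType R) (p : A -> L) (w : L) :
  linear p ->
  (forall a b, dot (p a) (p b) = dot (p (cmul (star b) a)) w) ->
  forall a, `|p a| <= `|a| * `|w|.
Proof.
move=> plin pdot a.
have pd k b c : dot (p (k *: b + c)) w = k * dot (p b) w + dot (p c) w.
  by rewrite plin dot_linear.
have pp b : 0 <= dot (p (cmul (star b) b)) w by rewrite -pdot -dot_norm exprn_ge0.
rewrite -(ler_pXn2r (_ : 0 < 2)%N) ?nnegrE ?mulr_ge0// exprMn dot_norm pdot.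
apply: le_trans (positive_functional_le pd pp a) _.
rewrite ler_wpM2l ?exprn_ge0//.
have p1 : dot (p cone) w = `|p cone| ^+ 2.
  by rewrite dot_norm pdot star1 cmul1a.
(* Pythagoras: [|w - p 1|^2 = |w|^2 - |p 1|^2]. *)
have : 0 <= `|w - p cone| ^+ 2 by rewrite exprn_ge0.
have dotN (x y z : L) : dot (x - y) z = dot x z - dot y z.
  by rewrite -scaleN1r addrC dot_linear mulN1r addrC.
have dotNr (x y z : L) : dot z (x - y) = dot z x - dot z y.
  by rewrite dot_conj dotN rmorphB/= -!dot_conj.
have wp1 : dot w (p cone) = `|p cone| ^+ 2.
  by rewrite dot_conj p1; apply/CrealP; rewrite realX// normr_real.
rewrite dot_norm dotN !dotNr wp1 p1 -!dot_norm.
by rewrite subrr subr0 subr_ge0.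
Qed.

End CStarAlgebraTheory.

(** * Hilbert spaces and representations *)

Section HilbertSpaceTheory.
Variables (R : realType) (H : hilbertSpaceType R).

Lemma dotDl (x y z : H) : dot (x + y) z = dot x z + dot y z.
Proof. by rewrite -[x]scale1r dot_linear mul1r scale1r. Qed.

Lemma dot0l (z : H) : dot 0 z = 0.
Proof. by apply: (addrI (dot 0 z)); rewrite -dotDl !addr0. Qed.

Lemma dot_suml (T : Type) (s : seq T) (f : T -> H) (z : H) :
  dot (\sum_(i <- s) f i) z = \sum_(i <- s) dot (f i) z.
Proof. exact: (big_morph (fun x => dot x z) (fun x y => dotDl x y z) (dot0l z)). Qed.

Lemma dot_sumr (T : Type) (s : seq T) (f : T -> H) (z : H) :
  dot z (\sum_(i <- s) f i) = \sum_(i <- s) dot z (f i).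
Proof.
by rewrite dot_conj dot_suml rmorph_sum/=; apply: eq_bigr => i _; rewrite -dot_conj.
Qed.

Lemma dot_representation (A : cstarAlgType R) (rho : A -> H -> H) a b h k :
  representation rho ->
  dot (rho a h) (rho b k) = dot (rho (cmul (star b) a) h) k.
Proof. by case=> _ _ rhoM rho_star; rewrite rhoM [RHS]rho_star starK. Qed.

End HilbertSpaceTheory.

Lemma linear_sum_seq (R : realType) (V W : lmodType R[i]) (T : Type) (s : seq T)
    (f : T -> V -> W) :
  (forall i, linear (f i)) -> linear (fun x => \sum_(i <- s) f i x).
Proof.
move=> flin k x y; rewrite scaler_sumr -big_split/=.
by apply: eq_bigr => i _; rewrite flin.
Qed.

(** * Norms of elementary tensors *)

Section TensorNorms.
Variable R : realType.

(** [rho a (x) sigma b] is the composite of [rho a (x) 1] and [1 (x) sigma b], and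
    each of the two is a representation of one of the algebras. *)
Lemma representation_tensor_norm_le (A B : cstarAlgType R)
    (H K L : hilbertSpaceType R) (t : H -> K -> L)
    (rho : A -> H -> H) (sigma : B -> K -> K) (a : A) (b : B) (z : seq (H * K)) :
  hilbert_space_tensor t -> representation rho -> representation sigma ->
  `|\sum_(q <- z) t (rho a q.1) (sigma b q.2)|
    <= `|a| * `|b| * `|\sum_(q <- z) t q.1 q.2|.
Proof.
move=> [[tl tr] tdot _] rep srep; rewrite -mulrA.
apply: (@le_trans _ _ (`|a| * `|\sum_(q <- z) t q.1 (sigma b q.2)|)).
  pose p a' := \sum_(q <- z) t (rho a' q.1) (sigma b q.2).
  apply: (@orbit_norm_le _ _ _ p).
    case: (rep) => [[rl _] _ _ _].
    by apply: linear_sum_seq => q k x y; rewrite rl tl.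
  move=> c d; rewrite /p !dot_suml; apply: eq_bigr => q _.
  rewrite !dot_sumr; apply: eq_bigr => r _.
  by rewrite !tdot (dot_representation _ _ _ _ rep).
rewrite ler_wpM2l//.
pose p b' := \sum_(q <- z) t q.1 (sigma b' q.2).
apply: (@orbit_norm_le _ _ _ p).
  case: (srep) => [[sl _] _ _ _].
  by apply: linear_sum_seq => q k x y; rewrite sl tr.
move=> c d; rewrite /p !dot_suml; apply: eq_bigr => q _.
rewrite !dot_sumr; apply: eq_bigr => r _.
by rewrite !tdot (dot_representation _ _ _ _ srep).
Qed.

Lemma spatial_tensor_norm_le (A B AB : cstarAlgType R) (t : A -> B -> AB) a b :
  spatial_tensor t -> `|t a b| <= `|a| * `|b|.
Proof.
case=> _ _ _ /(_ [:: (a, b)]) + _; rewrite big_seq1 => -[_]; apply.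
move=> _ [H [K [L [th [rho [sigma [z [th_t rrho rsigma z1 ->]]]]]]]].
rewrite big_seq1.
apply: le_trans (representation_tensor_norm_le _ _ _ th_t rrho rsigma) _.
by rewrite ler_piMr// mulr_ge0.
Qed.

Lemma module_tensor_norm_le (A B AB : cstarAlgType R) (tAB : A -> B -> AB)
    (E : hilbertModType A) (F : hilbertModType B) (EF : hilbertModType AB)
    (t : E -> F -> EF) x y :
  spatial_tensor tAB -> hilbert_module_tensor tAB t -> `|t x y| <= `|x| * `|y|.
Proof.
move=> tABs [_ _ t_inner _].
rewrite -(ler_pXn2r (_ : 0 < 2)%N) ?nnegrE ?mulr_ge0// exprMn !inner_norm t_inner.
exact: spatial_tensor_norm_le.
Qed.

End TensorNorms.

(** * Hilbert modules *)

Section HilbertModuleTheory.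
Variables (R : realType) (A : cstarAlgType R) (E : hilbertModType A).
Implicit Types x y z : E.

Lemma innerDl x y z : inner (x + y) z = inner x z + inner y z.
Proof. by rewrite -[x in LHS]act1 inner_linear cmul1a. Qed.

Lemma inner0l z : inner 0 z = 0.
Proof. by apply: (addrI (inner 0 z)); rewrite -innerDl !addr0. Qed.

Lemma inner_actl a x z : inner (act a x) z = cmul a (inner x z).
Proof. by rewrite -[act a x]addr0 inner_linear inner0l addr0. Qed.

Lemma act_scale1 (k : R[i]) x : act (k *: cone) x = k *: x.
Proof. by rewrite actZl act1. Qed.

Lemma innerZl (k : R[i]) x z : inner (k *: x) z = k *: inner x z.
Proof. by rewrite -act_scale1 inner_actl cmulZl cmul1a. Qed.

Lemma innerBl x y z : inner (x - y) z = inner x z - inner y z.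
Proof. by rewrite innerDl -scaleN1r innerZl scaleN1r. Qed.

Lemma innerDr x y z : inner x (y + z) = inner x y + inner x z.
Proof. by rewrite inner_star innerDl starD -!inner_star. Qed.

Lemma innerZr (k : R[i]) x z : inner x (k *: z) = Num.conj k *: inner x z.
Proof. by rewrite inner_star innerZl starZ -!inner_star. Qed.

Lemma inner_inj x y : (forall z, inner x z = inner y z) -> x = y.
Proof.
move=> xy; apply/eqP; rewrite -subr_eq0; apply/eqP/(inner_eq0 (x - y)).
by rewrite innerBl xy subrr.
Qed.

(** A weak form of the Cauchy-Schwarz inequality.  For unit vectors,
    [<u, v> + <v, u>] is a combination of values [<w, w>], whose norms are known,
    and replacing [v] by [i v] gives the same bound for the difference
    [<u, v> - <v, u>]. *)
Lemma inner_norm_le x y : `|inner x y| <= 6 * (`|x| * `|y|).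
Proof.
have cross (u v : E) : `|u| = 1 -> `|v| = 1 -> `|inner u v + inner v u| <= 6.
  move=> u1 v1.
  have -> : inner u v + inner v u =
      inner (u + v) (u + v) - (inner u u + inner v v).
    rewrite innerDl !innerDr (addrC (inner v u)) addrACA.
    by rewrite [RHS]addrAC subrr add0r.
  apply: le_trans (ler_normB _ _) _.
  rewrite [leRHS](_ : _ = (1 + 1) ^+ 2 + (1 ^+ 2 + 1 ^+ 2)); last by ring.
  apply: lerD; rewrite -?inner_norm.
    by have := ler_normD u v; rewrite u1 v1 ler_pXn2r ?nnegrE.
  by apply: le_trans (ler_normD _ _) _; rewrite -!inner_norm u1 v1.
have unit (u v : E) : `|u| = 1 -> `|v| = 1 -> `|inner u v| <= 6.
  move=> u1 v1; have i1 : `|'i : R[i]| = 1 by rewrite normCi.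
  have := cross u ('i *: v) u1; rewrite normrZ i1 mul1r => /(_ v1) c2.
  have uvE : 2 *: inner u v =
      (inner u v + inner v u) + 'i *: (inner u ('i *: v) + inner ('i *: v) u).
    rewrite innerZr innerZl conjCi scalerDr !scalerA mulrN -expr2 sqrCi.
    by rewrite opprK scale1r scaleN1r addrACA subrr addr0 scaler_nat mulr2n.
  rewrite -(ler_pM2l (_ : 0 < 2 :> R[i]))//.
  rewrite -[X in X * `|_|]normr_nat -normrZ uvE mulr_natl mulr2n.
  apply: le_trans (ler_normD _ _) _; rewrite lerD ?cross//.
  by rewrite normrZ i1 mul1r.
have [->|x0] := eqVneq x 0; first by rewrite inner0l !normr0 mul0r mulr0.
have [->|y0] := eqVneq y 0.
  by rewrite inner_star inner0l norm_star !normr0 !mulr0.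
have nx : 0 < `|x| by rewrite normr_gt0.
have ny : 0 < `|y| by rewrite normr_gt0.
have normed (w : E) : w != 0 -> `| `|w|^-1 *: w| = 1.
  by move=> w0; rewrite normrZ normfV normr_id mulVf ?normr_eq0.
have := unit _ _ (normed _ x0) (normed _ y0).
rewrite innerZl innerZr !normrZ norm_conjC !normfV !normr_id.
by rewrite ler_pdivrMl// ler_pdivrMl// mulrA mulrC (mulrC `|x|).
Qed.

Lemma adjointable_linear (S : E -> E) : adjointable S -> linear S.
Proof. by move=> [Slin _] k x y; rewrite -act_scale1 Slin act_scale1. Qed.

Lemma adjointable0 (S : E -> E) : adjointable S -> S 0 = 0.
Proof.
move=> adS; have := adjointable_linear adS 1 0 0; rewrite !scale1r addr0 => S00.
by apply: (addrI (S 0)); rewrite addr0.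
Qed.

Lemma adjointable_act (S : E -> E) a x : adjointable S -> S (act a x) = act a (S x).
Proof.
by move=> adS; rewrite -[act a x]addr0 (proj1 adS) (adjointable0 adS) addr0.
Qed.

End HilbertModuleTheory.

(** * Adjointable maps are bounded *)

Section AdjointableBounded.
Variables (R : realType) (A : cstarAlgType R) (E : hilbertModType A).

(** The difference of [x + y] and [x - y] is [2 y]. *)
Lemma norm_half_step (V : normedModType R[i]) (x y : V) :
  `|y| <= `|x + y| \/ `|y| <= `|x - y|.
Proof.
apply/orP; rewrite -implyNb; apply/implyP.
rewrite -real_ltNge ?normr_real// => lt_y; rewrite real_leNgt ?normr_real//.
apply/negP => lt_y'; have /lt_geF/negbT/negP := ltrD lt_y lt_y'; apply.
apply: le_trans (ler_normB _ _).
by rewrite opprB [x + y + _]addrC addrA subrK -mulr2n normrMn mulr2n.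
Qed.

(** Gliding hump.  If [S] is unbounded, there are [y n] with
    [|S (y n)| > 16^n n |y n|].  Add up vectors of norm [16^-n] parallel to
    [S (y n)], with signs such that the [n]-th pairing [f n], that is
    [<., S (y n)>], has norm at least [16^-n |S (y n)|] on the partial sum [n.+1].
    The later steps add up to at most [16^-n / 15], so that on the limit [l] the
    pairing keeps the norm [(1 - 6 / 15) 16^-n |S (y n)|], where 6 is the constant
    of [inner_norm_le].  On the other hand, the pairing of [l] with [S (y n)] is
    that of [T l] with [y n] up to the involution, hence of norm at most
    [6 |T l| |y n|]; so [n <= 10 |T l|] for every [n]. *)
Lemma adjointable_bounded (S : E -> E) : adjointable S -> bounded_op S.
Proof.
move=> adS; have [_ [T ST]] := adS; apply/not_existsP => unbounded.
have /choice[y yP] : forall n : nat, exists x : E,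
    ((16 ^+ n * n%:R)%:C * `|x| < `|S x|).
  move=> n; have /existsNP[x] := unbounded (16 ^+ n * n%:R).
  move=> /negP; rewrite -real_ltNge ?realM ?normr_real// => [lt_x|].
    by exists x.
  by rewrite ger0_real// lecR mulr_ge0// exprn_ge0.
have Sy_gt0 n : 0 < `|S (y n)|.
  by apply: le_lt_trans (yP n); rewrite mulr_ge0// lecR mulr_ge0// exprn_ge0.
have y_gt0 n : 0 < `|y n|.
  rewrite normr_gt0; apply/eqP => yn0.
  by have := Sy_gt0 n; rewrite yn0 (adjointable0 adS) normr0 ltxx.
pose q : R := 16^-1; have q01 : 0 <= q < 1 by rewrite invr_ge0 ler0n invf_lt1 ?ltr1n.
pose d n := ((q ^+ n)%:C / `|S (y n)|) *: S (y n).
pose f n (w : E) := inner w (S (y n)).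
pose step n w := if `|f n (d n)| <= `|f n (w + d n)| then w + d n else w - d n.
pose z := fix z n := if n is m.+1 then step m (z m) else 0.
have qn0 n : 0 <= (q ^+ n)%:C by rewrite lecR exprn_ge0//; case/andP: q01.
have norm_d n : `|d n| = (q ^+ n)%:C.
  by rewrite normrZ normrM normfV normr_id mulfVK ?gt_eqF// ger0_norm.
have norm_fd n : `|f n (d n)| = (q ^+ n)%:C * `|S (y n)|.
  rewrite /f innerZl normrZ -inner_norm normrM normfV normr_id ger0_norm//.
  by rewrite expr2 mulrA mulfVK ?gt_eqF.
have fz n : (q ^+ n)%:C * `|S (y n)| <= `|f n (z n.+1)|.
  rewrite -norm_fd /= /step; case: ifPn => // /negP ltd.
  by have [] := norm_half_step (f n (z n)) (f n (d n)); rewrite /f -?innerDl -?innerBl.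
have dz n : `|z n.+1 - z n| <= (1 * q ^+ n)%:C.
  rewrite mul1r /= /step; case: ifPn => _; rewrite addrAC subrr add0r ?normrN.
    by rewrite norm_d.
  by rewrite norm_d.
have [l lP] := geometric_limit q01 dz.
have [k k0 kE] := ge0_realE (normr_ge0 (T l)).
suff : (Num.truncn (10 * k)).+1%:R <= 10 * k.
  by rewrite leNgt truncnS_gt.
pose n := (Num.truncn (10 * k)).+1.
have [s s0 sE] := gt0_realE (Sy_gt0 n).
have [r r0 rE] := gt0_realE (y_gt0 n).
have fl : `|f n l| <= 6 * (`|y n| * `|T l|).
  by rewrite /f inner_star norm_star ST inner_norm_le.
have : `|f n (z n.+1)| <= `|f n l| + `|f n (l - z n.+1)|.
  by rewrite {3}/f innerBl -{1}(subKr (f n l) (f n (z n.+1))) ler_normB.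
move=> /(le_trans (fz n)); move=> /le_trans/(_ (lerD fl (inner_norm_le _ _))).
have := yP n; rewrite rE kE sE -rmorphM ltcR => sr.
move=> /le_trans main.
have {main} : (q ^+ n)%:C * s%:C <=
    6 * (r%:C * k%:C) + 6 * ((1 / (1 - q) * q ^+ n.+1)%:C * s%:C).
  by apply: main; rewrite lerD2l ler_wpM2l// ler_wpM2r// ?lecR ?ltW.
have -> : (6 : R[i]) = 6%:C by rewrite rmorph_nat.
rewrite -!(rmorphM, rmorphD)/= lecR.
have qE : 1 / (1 - q) = 16 / 15 by rewrite /q; field.
have qE16 : q ^+ n * 16 ^+ n = 1 by rewrite -exprMn mulVf ?expr1n.
have p0 : 0 < q ^+ n by rewrite exprn_gt0 ?invr_gt0.
rewrite exprS qE {2}/q => main.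
have ps : q ^+ n * s <= 10 * (r * k) by lra.
have nr : n%:R * r < q ^+ n * s.
  rewrite (_ : n%:R * r = q ^+ n * (16 ^+ n * n%:R * r)) ?ltr_pM2l//.
  by rewrite !mulrA qE16 mul1r.
rewrite -(ler_pM2r r0); apply/ltW/(lt_le_trans nr).
by rewrite -mulrA (mulrC k).
Qed.

End AdjointableBounded.

(** * Unordered sums *)

Section UnorderedSums.
Variable R : realType.

#[local] Existing Instance totally_filter.

Lemma has_sum_dist (V : normedModType R[i]) (I : choiceType) (f : I -> V) s
    (e : R[i]) : has_sum f s -> 0 < e ->
  exists K, forall L, (K `<=` L)%fset -> `|s - partial_sum f L| < e.
Proof.
move=> fs e0; have /cvgrPdist_lt/(_ _ e0) [K _ KP] := fs.
by exists K => L; exact: KP.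
Qed.

Lemma has_sum_unique (V : normedModType R[i]) (I : choiceType) (f : I -> V) s s' :
  has_sum f s -> has_sum f s' -> s = s'.
Proof. exact: norm_cvg_unique. Qed.

Lemma has_sum_additive (V W : normedModType R[i]) (phi : V -> W) (M : R[i])
    (I : choiceType) (f : I -> V) s :
  (forall x y, phi (x + y) = phi x + phi y) ->
  0 <= M -> (forall x, `|phi x| <= M * `|x|) ->
  has_sum f s -> has_sum (fun i => phi (f i)) (phi s).
Proof.
move=> phiD M0 phiM fs.
have phi0 : phi 0 = 0 by apply: (addrI (phi 0)); rewrite -phiD !addr0.
have phiB x y : phi (x - y) = phi x - phi y.
  by apply/eqP; rewrite eq_sym subr_eq -phiD subrK.
apply/cvgrPdist_lt => e e0; have M1 : 0 < M + 1 by rewrite ltr_wpDl.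
have [K KP] := has_sum_dist fs (divr_gt0 e0 M1).
exists K => // L /KP.
rewrite /partial_sum -(big_morph phi phiD phi0) -phiB ltr_pdivlMr//.
apply: le_lt_trans; apply: le_trans (phiM _) _.
by rewrite mulrC ler_wpM2l// lerDl.
Qed.

Lemma partial_sumE (Z : zmodType) (I : choiceType) (f : I -> Z) (P : {fset I}) :
  partial_sum f P = \sum_(i <- P) f i.
Proof. by rewrite /partial_sum big_seq_fsetE. Qed.

Lemma partial_sum_rectangle (Z : zmodType) (I J : choiceType)
    (h : I * J -> Z) (P : {fset I}) (Q : {fset J}) :
  partial_sum h (P `*` Q)%fset = \sum_(i <- P) \sum_(j <- Q) h (i, j).
Proof.
rewrite partial_sumE.
transitivity (\sum_(p <- [seq (i, j) | i <- P, j <- Q]) h p); last first.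
  by rewrite big_allpairs.
apply: perm_big.
apply: uniq_perm; first exact: fset_uniq.
  by apply: allpairs_uniq; rewrite ?fset_uniq// => -[? ?] [? ?].
move=> [i j]; rewrite in_fsetM/=; apply/andP/allpairsP => /=.
  by move=> [iP jQ]; exists (i, j).
by move=> [[i' j'] /= [iP jQ [-> ->]]].
Qed.

(** The sum over [I * J] is assumed to exist; it is identified by evaluating
    it on rectangles, where it factors. *)
Lemma has_sum_bilinear (V W Z : normedModType R[i]) (g : V -> W -> Z) (M : R[i])
    (I J : choiceType) (a : I -> V) (b : J -> W) x y s :
  (forall x x' y, g (x + x') y = g x y + g x' y) ->
  (forall x y y', g x (y + y') = g x y + g x y') ->
  0 <= M -> (forall x y, `|g x y| <= M * (`|x| * `|y|)) ->
  has_sum a x -> has_sum b y ->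
  has_sum (fun ij : I * J => g (a ij.1) (b ij.2)) s -> s = g x y.
Proof.
move=> gDl gDr M0 gM ax by_ hs.
have g0l z : g 0 z = 0 by apply: (addrI (g 0 z)); rewrite -gDl !addr0.
have g0r z : g z 0 = 0 by apply: (addrI (g z 0)); rewrite -gDr !addr0.
have gBl x1 x2 z : g (x1 - x2) z = g x1 z - g x2 z.
  by apply/eqP; rewrite eq_sym subr_eq -gDl subrK.
have gBr z x1 x2 : g z (x1 - x2) = g z x1 - g z x2.
  by apply/eqP; rewrite eq_sym subr_eq -gDr subrK.
apply/eqP; rewrite -subr_eq0 -normr_le0.
have [r r0 rE] := ge0_realE (normr_ge0 (s - g x y)); rewrite rE lecR.
apply/ler_addgt0Pr => e e0; rewrite add0r -lecR -rE.
have e20 : 0 < e%:C / 2 by rewrite divr_gt0// ltcR.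
pose c := M * (`|x| + `|y| + 1); have c0 : 0 <= c by rewrite mulr_ge0// !addr_ge0.
have c1 : 0 < c + 1 by rewrite ltr_wpDl.
have d0 := divr_gt0 e20 c1; set d := _ / _ in d0.
have [K KP] := has_sum_dist hs e20.
have [P PP] := has_sum_dist ax d0.
(* [P'] keeps the partial sums of [a] in the ball of radius [|x| + 1]. *)
have [P' PP'] := has_sum_dist ax ltr01.
have [Q QP] := has_sum_dist by_ d0.
pose P1 := (P `|` P' `|` [fset p.1 | p in K])%fset.
pose Q1 := (Q `|` [fset p.2 | p in K])%fset.
have := KP (P1 `*` Q1)%fset; have := PP P1; have := PP' P1; have := QP Q1.
have -> : partial_sum (fun ij : I * J => g (a ij.1) (b ij.2)) (P1 `*` Q1)%fset
    = g (partial_sum a P1) (partial_sum b Q1).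
  rewrite partial_sum_rectangle !partial_sumE/=.
  rewrite (big_morph (fun u => g u _) (fun u v => gDl u v _) (g0l _)).
  by apply: eq_bigr => i _; rewrite (big_morph (g (a i)) (gDr _) (g0r _)).
set xP := partial_sum a P1; set yQ := partial_sum b Q1.
move=> /(_ (fsubsetUl _ _)) yd.
move=> /(_ (fsubset_trans (fsubsetUr _ _) (fsubsetUl _ _))) x1.
move=> /(_ (fsubset_trans (fsubsetUl _ _) (fsubsetUl _ _))) xd.
have KPQ : (K `<=` P1 `*` Q1)%fset.
  apply/fsubsetP => -[i j] ijK; rewrite in_fsetM/= !in_fsetU.
  apply/andP; split; apply/orP; right; apply/imfsetP; by exists (i, j).
move=> /(_ KPQ) sd.
apply: le_trans (ler_distD (g xP yQ) _ _) _.
have -> : e%:C = e%:C / 2 + e%:C / 2 by rewrite -splitr.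
apply: lerD; first exact: ltW.
have -> : g xP yQ - g x y = g xP (yQ - y) + g (xP - x) y.
  by rewrite gBl gBr addrA subrK.
apply: le_trans (ler_normD _ _) _.
have xPle : `|xP| <= `|x| + 1.
  by rewrite -[xP](subKr x); apply: le_trans (ler_normB _ _) _; rewrite lerD2l ltW.
apply: (@le_trans _ _ (c * d)); last first.
  by rewrite /d mulrA ler_pdivrMr// mulrC ler_wpM2l ?(ltW e20)// lerDl.
rewrite /c [leRHS](_ : _ = M * ((`|x| + 1) * d) + M * (d * `|y|)); last by ring.
apply: lerD; apply: le_trans (gM _ _) _; rewrite ler_wpM2l//.
  by apply: ler_pM => //; rewrite distrC ltW.
by rewrite ler_wpM2r// distrC ltW.
Qed.

End UnorderedSums.

(** * Frame operators *)

Section FrameOperators.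
Variables (R : realType) (A : cstarAlgType R) (E : hilbertModType A).
Variables (I : choiceType) (u : I -> E) (S : E -> E).

Lemma has_sum_inner (f : I -> E) s (y : E) :
  has_sum f s -> has_sum (fun i => inner (f i) y) (inner s y).
Proof.
apply: (@has_sum_additive _ _ _ (fun x => inner x y) (6 * `|y|)).
- by move=> x x'; rewrite innerDl.
- by rewrite mulr_ge0.
- by move=> x; rewrite -mulrA (mulrC `|y|) inner_norm_le.
Qed.

(** The involution exchanges the terms of the expansion of [<S a, b>] with
    those of the expansion of [<S b, a>]; being isometric, it commutes with
    unordered sums. *)
Lemma frame_operator_selfadjoint x y :
  frame_operator u S -> inner (S x) y = inner x (S y).
Proof.
move=> [[_ [T ST]] SE].
have expand a b : has_sum (fun i => cmul (inner a (S (u i))) (inner (S (u i)) b))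
    (inner (S a) b).
  have := has_sum_inner (y := T b) (proj1 (SE a)).
  by under eq_fun do rewrite inner_actl -ST; rewrite -ST.
apply: has_sum_unique (expand x y) _; rewrite inner_star.
under eq_fun do rewrite (inner_star x) (inner_star _ y) -starM.
apply: (@has_sum_additive _ _ _ (@star _ A) 1) (expand y x) => //.
  exact: starD.
by move=> a; rewrite mul1r norm_star.
Qed.

Lemma frame_operator_inverse x :
  frame_operator u S -> has_sum (fun i => act (inner (S x) (u i)) (u i)) x.
Proof.
move=> uS; have := proj1 (proj2 uS x).
by under eq_fun do rewrite -frame_operator_selfadjoint//.
Qed.

End FrameOperators.

(** * The frame operator of a tensor product of frames *)

Theorem theorem3p3 (R : realType)
  (A B AB : cstarAlgType R) (tAB : A -> B -> AB)
  (E : hilbertModType A) (F : hilbertModType B) (EF : hilbertModType AB)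
  (tEF : E -> F -> EF) (I J : countType) (u : I -> E) (v : J -> F)
  (S : E -> E) (S' : F -> F) (S'' : EF -> EF) :
  spatial_tensor tAB ->
  hilbert_module_tensor tAB tEF ->
  finitely_generated E \/ countably_generated E ->
  finitely_generated F \/ countably_generated F ->
  standard_frame u ->
  standard_frame v ->
  frame_operator u S ->
  frame_operator v S' ->
  frame_operator (fun ij : I * J => tEF (u ij.1) (v ij.2)) S'' ->
  tensor_operator tEF S S' S''.
Proof.
move=> tABs tEFs _ _ _ _ uS vS' [adS'' S''E].
split; [exact: adjointable_linear|exact: adjointable_bounded|move=> x y].
have [[tl tr] tact tinner _] := tEFs.
have [_ [T S''T]] := adS''.
apply: inner_inj => z; apply/esym; rewrite S''T.
pose g x' y' := inner (tEF x' y') (T z).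
apply: (has_sum_bilinear (V := E) (W := F) (Z := AB) (g := g) (M := 6 * `|T z|) _ _ _ _
  (frame_operator_inverse (x := x) uS) (frame_operator_inverse (x := y) vS')).
- by move=> x1 x2 y1; rewrite /g -{1}[x1]scale1r tl innerDl innerZl scale1r.
- by move=> x1 y1 y2; rewrite /g -{1}[y1]scale1r tr innerDl innerZl scale1r.
- by rewrite mulr_ge0.
- move=> x1 y1; apply: le_trans (inner_norm_le _ _) _.
  rewrite -mulrA ler_wpM2l// mulrC ler_wpM2l//.
  exact: module_tensor_norm_le tABs tEFs.
have := has_sum_inner (y := z) (proj2 (S''E (tEF (S x) (S' y)))).
by under eq_fun do rewrite -adjointable_act// tinner tact S''T.
Qed.
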